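(* There exists a Mazurkiewicz set $M\subseteq\mathbb{R}^2$ such that for every rotation $\rho$ of $\mathbb{R}^2$ about the origin, the set $\rho[M]$ contains the graph of no Sierpiński-Zygmund function $f\colon\mathbb{R}\to\mathbb{R}$.
   Context: Work in ZFC; $\mathfrak{c}$ denotes the cardinality of $\mathbb{R}$. Functions and partial functions from $\mathbb{R}$ into $\mathbb{R}$ are identified with their graphs (subsets of $\mathbb{R}^2$). A Mazurkiewicz set is a set $M\subseteq\mathbb{R}^2$ that intersects every straight line of $\mathbb{R}^2$ in exactly two points. A set $X\subseteq\mathbb{R}^2$ is a Sierpiński-Zygmund set if $|X\cap f|<\mathfrak{c}$ for every continuous partial function $f$ from $\mathbb{R}$ into $\mathbb{R}$ (i.e. continuous function defined on some subset of $\mathbb{R}$). A Sierpiński-Zygmund function is a (total) function $f\colon\mathbb{R}\to\mathbb{R}$ whose graph is a Sierpiński-Zygmund set. *)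

(* Defs.v *)
From mathcomp Require Import all_boot all_order all_algebra.
From mathcomp Require Import all_classical all_reals all_analysis.

Set Implicit Arguments.
Unset Strict Implicit.
Unset Printing Implicit Defensive.

Import Order.TTheory GRing.Theory Num.Theory.
Import numFieldNormedType.Exports.

Local Open Scope classical_set_scope.
Local Open Scope card_scope.
Local Open Scope ring_scope.

Definition card_lt (T U : Type) (A : set T) (B : set U) : Prop :=
  A #<= B /\ A #!= B.

Definition line (R : realType) (a b c : R) : set (R * R) :=
  [set p | a * p.1 + b * p.2 = c].

Definition straight_line (R : realType) (L : set (R * R)) : Prop :=
  exists a b c : R, (a, b) <> (0, 0) /\ L = line a b c.

Definition mazurkiewicz (R : realType) (M : set (R * R)) : Prop :=
  forall L : set (R * R), straight_line L -> M `&` L #= `I_2.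

(* A partial function with domain D is represented by any total function that
   extends it; only the values on D matter for its graph. *)
Definition graph_on (R : realType) (D : set R) (f : R -> R) : set (R * R) :=
  [set p | D p.1 /\ p.2 = f p.1].

(* {within D, continuous f} is continuity of the restriction of f to D for the
   topology induced on D: nothing is required of f outside D. *)
Definition sierpinski_zygmund_set (R : realType) (X : set (R * R)) : Prop :=
  forall (D : set R) (f : R -> R), {within D, continuous f} ->
    card_lt (X `&` graph_on D f) [set: R].

Definition sierpinski_zygmund_fun (R : realType) (f : R -> R) : Prop :=
  sierpinski_zygmund_set (graph_on [set: R] f).

Definition rotation (R : realType) (t : R) (p : R * R) : R * R :=
  (cos t * p.1 - sin t * p.2, sin t * p.1 + cos t * p.2).

(* Main.v *)
Require Import Defs.
From mathcomp Require Import all_boot all_order all_algebra.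
From mathcomp Require Import all_classical all_reals all_analysis.
From mathcomp Require Import wochoice finmap ring lra.

(** Enumerate, along a well-order of R whose proper initial segments have fewer
    than |R| elements, all lines together with |R| many copies of every angle t,
    and build M by transfinite recursion without ever creating three collinear
    points. At each stage the < |R| points chosen so far span < |R| lines (by
    Hessenberg's theorem), so one can complete the current line to two points,
    and one can also add two points that the rotation by t sends to (s, s^2) and
    (s, s^2 + 1), for a new abscissa s. In the end, if the graph of f lies in the
    rotation of M by t, then f(s) is s^2 or s^2 + 1 for |R| many s, so f agrees
    with one of these two continuous functions at |R| many points. *)

Set Implicit Arguments.
Unset Strict Implicit.
Unset Printing Implicit Defensive.

Import Order.TTheory GRing.Theory Num.Theory.
Import numFieldNormedType.Exports.

Local Open Scope classical_set_scope.

(** * Cardinal arithmetic *)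

(** Zorn's lemma on graphs of partial bijections between [X] and its complement: a maximal one
    exhausts one of the two sides, otherwise an unmatched pair could be added. *)
Lemma set_comparable (T : Type) (X : set T) :
  (exists j : T -> T, (forall x, X x -> ~ X (j x)) /\
     (forall x y, X x -> X y -> j x = j y -> x = y)) \/
  (exists k : T -> T, (forall x, ~ X x -> X (k x)) /\
     (forall x y, ~ X x -> ~ X y -> k x = k y -> x = y)).
Proof.
pose P (G : set (T * T)) := (forall p, G p -> X p.1 /\ ~ X p.2) /\
  (forall p q, G p -> G q -> (p.1 = q.1 <-> p.2 = q.2)).
have [F FP Ftot|G [[GX Gf] Gmax]] := @Zorn_bigcup _ P.
  split=> [p [G FG Gp]|p q [G FG Gp] [H FH Hq]]; first exact: (FP G FG).1.
  have [GH|HG] := Ftot G H FG FH; first by apply: (FP H FH).2 => //; exact: GH.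
  by apply: (FP G FG).2 => //; exact: HG.
have [domG|/existsNP[u /not_implyP[Xu /forallNP NGu]]] :=
  pselect (forall x, X x -> exists y, G (x, y)).
  left; have /choice[j Gj] x : exists y, X x -> G (x, y).
    have [/domG[y Gy]|NX] := pselect (X x); last by exists x.
    by exists y.
  exists j; split=> [x /Gj/GX[]//|x y /Gj Gx /Gj Gy jxy].
  by apply/(Gf _ _ Gx Gy).
have [ranG|/existsNP[v /not_implyP[NXv /forallNP NGv]]] :=
  pselect (forall y, ~ X y -> exists x, G (x, y)).
  right; have /choice[k Gk] y : exists x, ~ X y -> G (x, y).
    have [Xy|/ranG[x Gx]] := pselect (X y); first by exists y.
    by exists x.
  exists k; split=> [x /Gk/GX[]//|x y /Gk Gx /Gk Gy kxy].
  by apply/(Gf _ _ Gx Gy).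
exfalso; apply: (Gmax (G `|` [set (u, v)])).
  split=> [p Gp|/(_ (u, v) (or_intror erefl))]; [by left | exact: NGu].
split=> [p [/GX//|->//]|[a b] [c d] [Gp|[-> ->]] [Gq|[-> ->]] //=].
- exact: (Gf _ _ Gp Gq).
- by split=> e; move: Gp; rewrite e => ?; [case: (NGu b)|case: (NGv a)].
- by split=> e; move: Gq; rewrite -e => ?; [case: (NGu d)|case: (NGv c)].
Qed.

(** * Hessenberg's theorem *)

Section Hessenberg.
Variables (T : choiceType) (i : nat -> T).
Hypothesis i_inj : injective i.

Let square_inj (X : set T) (f : T * T -> T) :=
  (forall x y, X x -> X y -> X (f (x, y))) /\
  (forall x y x' y', X x -> X y -> X x' -> X y' ->
     f (x, y) = f (x', y') -> x = x' /\ y = y').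

Let graph2 (X : set T) (f : T * T -> T) : set (T * T * T) :=
  [set p | [/\ X p.1.1, X p.1.2 & p.2 = f p.1]].

(** Graphs are used because their inclusion is extension of both the domain and the map. The
    alternative [X = set0] accounts for the union of the empty chain. *)
Let admissible (G : set (T * T * T)) := exists X f,
  [/\ G = graph2 X f, square_inj X f &
      X = set0 \/ exists k : nat -> T, injective k /\ forall n, X (k n)].

Let graph2_sub X f Y g : graph2 X f `<=` graph2 Y g -> 
  X `<=` Y /\ forall x y, X x -> X y -> f (x, y) = g (x, y).
Proof.
move=> sub; split=> [x Xx|x y Xx Xy].
  by case: (sub (x, x, f (x, x)) (And3 Xx Xx erefl)).
by case: (sub (x, y, f (x, y)) (And3 Xx Xy erefl)).
Qed.

(** Along a chain the values agree, and any two points of the union of the domains lie in a common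
    domain, so the maps glue. *)
Let admissible_bigcup (F : set (set (T * T * T))) :
  F `<=` admissible -> total_on F subset -> admissible (\bigcup_(G in F) G).
Proof.
move=> FP Ftot.
pose X := [set x | exists z, (\bigcup_(G in F) G) (x, x, z)].
have /choice[f fE] (p : T * T) : exists z, forall G, F G ->
    forall z', G (p, z') -> z' = z.
  have [[z [G FG Gz]]|NU] := pselect (exists z, (\bigcup_(G in F) G) (p, z)).
    exists z => H FH z' Hz'.
    have [GH|HG] := Ftot G H FG FH.
      have [Y [h [HE _ _]]] := FP _ FH; move: Hz' (GH _ Gz); rewrite HE.
      by move=> [_ _ /= ->] [_ _ /= ->].
    have [Y [h [GE _ _]]] := FP _ FG; move: Gz (HG _ Hz'); rewrite GE.
    by move=> [_ _ /= ->] [_ _ /= ->].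
  by exists p.1 => G FG z Gz; case: NU; exists z; exists G.
have memX x : X x <-> exists G Y g, [/\ F G, G = graph2 Y g & Y x].
  split=> [[z [G FG]]|[G [Y [g [FG GE Yx]]]]].
    have [Y [g [GE _ _]]] := FP _ FG.
    by move=> Gx; exists G, Y, g; split=> //; move: Gx; rewrite GE => -[].
  by exists (g (x, x)); exists G => //; rewrite GE.
have fG G Y g : F G -> G = graph2 Y g -> forall x y, Y x -> Y y ->
    f (x, y) = g (x, y).
  by move=> FG GE x y Yx Yy; apply/esym/(fE _ G) => //; rewrite GE.
have common x y : X x -> X y -> exists G Y g, [/\ F G, G = graph2 Y g, Y x & Y y].
  move=> /memX[G [Y [g [FG GE Yx]]]] /memX[H [Z [h [FH HE Zy]]]].
  have [|] := Ftot G H FG FH; rewrite {1}GE {1}HE => /graph2_sub[sub _].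
    by exists H, Z, h; split=> //; exact: sub.
  by exists G, Y, g; split=> //; exact: sub.
have FQ G Y g : F G -> G = graph2 Y g -> square_inj Y g.
  move=> FG GE; have [Z [h [GE' [hin hinj] _]]] := FP _ FG.
  have /graph2_sub[YZ gh] : graph2 Y g `<=` graph2 Z h by rewrite -GE -GE'.
  have /graph2_sub[ZY _] : graph2 Z h `<=` graph2 Y g by rewrite -GE -GE'.
  split=> [x y Yx Yy|x y x' y' Yx Yy Yx' Yy'].
    by rewrite gh//; apply/ZY/hin; exact: YZ.
  by rewrite !gh//; apply: hinj; exact: YZ.
exists X, f; split.
- apply/seteqP; split=> -[[x y] z] /=.
    move=> [G FG]; have [Y [g [GE _ _]]] := FP _ FG => Gxyz.
    have := Gxyz; rewrite GE => -[/= Yx Yy _].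
    split; [apply/memX|apply/memX|exact: (fE _ G)]; by exists G, Y, g.
  move=> [/= Xx Xy ->]; have [G [Y [g [FG GE Yx Yy]]]] := common _ _ Xx Xy.
  by exists G => //; rewrite (fG G Y g)// GE.
- split=> [x y Xx Xy|x y x' y' Xx Xy Xx' Xy'].
    have [G [Y [g [FG GE Yx Yy]]]] := common _ _ Xx Xy.
    apply/memX; exists G, Y, g; rewrite (fG G Y g)//.
    by split=> //; exact: (FQ G Y g FG GE).1.
  have [G [Y [g [FG GE Yx Yy]]]] := common _ _ Xx Xy.
  have [H [Z [h [FH HE Zx' Zy']]]] := common _ _ Xx' Xy'.
  have [|] := Ftot G H FG FH; rewrite {1}GE {1}HE => /graph2_sub[sub _].
    rewrite !(fG H Z h)//; try exact: sub.
    by apply: (FQ H Z h FH HE).2 => //; exact: sub.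
  rewrite !(fG G Y g)//; try exact: sub.
  by apply: (FQ G Y g FG GE).2 => //; exact: sub.
- have [[x Xx]|/nonemptyPn ->] := pselect (X !=set0); last by left.
  right; have /memX[G [Y [g [FG GE Yx]]]] := Xx.
  have [Z [h [GE' _ Zinf]]] := FP _ FG.
  have /graph2_sub[YZ _] : graph2 Y g `<=` graph2 Z h by rewrite -GE -GE'.
  case: Zinf => [Z0|[k [kinj kZ]]]; first by move: (YZ _ Yx); rewrite Z0.
  by exists k; split=> // n; apply/memX; exists G, Z, h.
Qed.

Let admissible_nat : admissible (graph2 (range i)
  (fun p => xget p.1 [set z | exists m n : nat,
     [/\ p = (i m, i n) & z = i (choice.pickle (m, n))]])).
Proof.
set f := (fun p : T * T => _).
have fE m n : f (i m, i n) = i (choice.pickle (m, n)).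
  rewrite /f; case: xgetP => [z _ [m' [n' [[/i_inj -> /i_inj ->] ->]]]//|/=].
  by move=> /(_ (i (choice.pickle (m, n)))) []; exists m, n.
exists (range i), f; split=> //; last by right; exists i; split=> // n; exists n.
split=> [_ _ [m _ <-] [n _ <-]|_ _ _ _ [m _ <-] [n _ <-] [m' _ <-] [n' _ <-]].
  by rewrite fE; exists (choice.pickle (m, n)).
rewrite !fE => /i_inj /(pcan_inj (@choice.pickleK _)) [-> ->] //.
Qed.

(** The domain is doubled by adding the copy of [X] under [j]. An element of [Y] is a base point
    [b x] in [X] with a bit [t x]. A new pair is coded in [X] by its two base points and two bits,
    then sent by [j] outside [X], away from the old values. *)
Let admissible_extend X f (k : nat -> T) (j : T -> T) : square_inj X f ->
  injective k -> (forall n, X (k n)) ->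
  (forall x, X x -> ~ X (j x)) ->
  (forall x y, X x -> X y -> j x = j y -> x = y) ->
  exists Y g, [/\ admissible (graph2 Y g), graph2 X f `<=` graph2 Y g & Y `\` X !=set0].
Proof.
move=> [fX f_inj] k_inj kX jX j_inj; pose Y := X `|` (j @` X).
pose b x := xget x [set y | X y /\ (y = x \/ j y = x)].
pose t x : bool := `[< X x >].
have bX x : X x -> b x = x.
  move=> Xx; rewrite /b; case: xgetP => [y _ [Xy [//|jyx]]|//].
  by case: (jX y) => //; rewrite jyx.
have bj x : X x -> b (j x) = x.
  move=> Xx; rewrite /b; case: xgetP => [y _ [Xy [yx|/j_inj ->//]]|/(_ x)[]].
    by case: (jX x) => //; rewrite -yx.
  by split=> //; right.
have bY x : Y x -> X (b x) by move=> [Xx|[y Xy <-]]; [rewrite bX|rewrite bj].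
have b_inj x y : Y x -> Y y -> t x = t y -> b x = b y -> x = y.
  move=> [Xx|[x' Xx' <-]] [Xy|[y' Xy' <-]]; rewrite /t.
  - by rewrite !bX.
  - by rewrite (asboolT Xx) => /esym/asboolP/(jX _ Xy').
  - by rewrite (asboolT Xy) => /asboolP/(jX _ Xx').
  - by rewrite !bj// => _ ->.
pose g p := if t p.1 && t p.2 then f p else
  j (f (f (b p.1, b p.2), k (choice.pickle (t p.1, t p.2)))).
have gX x y : X x -> X y -> g (x, y) = f (x, y).
  by move=> Xx Xy; rewrite /g /t !asboolT.
exists Y, g; split; last first.
- exists (j (k 0%N)); split; last exact: jX.
  by right; exists (k 0%N).
- by move=> [[x y] z] [/= Xx Xy ->]; split=> /=; [left|left|rewrite gX].
exists Y, g; split=> //; last by right; exists k; split=> // n; left.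
have XX x y : t x && t y -> X x /\ X y by move=> /andP[/asboolP ? /asboolP].
have ffX x y m : Y x -> Y y -> X (f (f (b x, b y), k m)).
  by move=> Yx Yy; apply: (fX) => //; apply: fX; exact: bY.
split=> [x y Yx Yy|x y x' y' Yx Yy Yx' Yy'].
  rewrite /g /=; case: ifPn => [/XX[Xx Xy]|_]; first by left; exact: fX.
  by right; eexists; last reflexivity; exact: ffX.
rewrite /g /=; case: ifPn => [/XX[Xx Xy]|_]; case: ifPn => [/XX[Xx' Xy']|_].
- exact: f_inj.
- move=> e; case: (jX _ (ffX x' y' (choice.pickle (t x', t y')) Yx' Yy')).
  by rewrite -e; exact: fX.
- move=> e; case: (jX _ (ffX x y (choice.pickle (t x, t y)) Yx Yy)).
  by rewrite e; exact: fX.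
move=> /j_inj-/(_ (ffX _ _ _ Yx Yy) (ffX _ _ _ Yx' Yy')).
move=> /f_inj[]//; try by apply: fX; exact: bY.
move=> /f_inj[]//; try exact: bY.
by move=> ebx eby /k_inj /(pcan_inj (@choice.pickleK _)) [etx ety]; split; exact: b_inj.
Qed.

(* Hessenberg's theorem: maximality forces the square-embedded set X to have
   the cardinality of T, otherwise X embeds in its complement and the pairs
   outside X * X can be coded in that copy. *)
Lemma infinite_square_inj : exists f : T * T -> T, injective f.
Proof.
have [G [[X [f [GE Qf Xinf]]] Gmax]] := Zorn_bigcup admissible_bigcup.
case: Xinf => [X0|[k [kinj kX]]].
  exfalso; apply: (Gmax _ _ admissible_nat); split.
    by rewrite GE X0 => p [].
  move=> sub; have [] : graph2 X f (i 0, i 0, i (choice.pickle (0, 0))) ; last by rewrite X0.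
  rewrite -GE; apply: sub; split; [by exists 0|by exists 0|].
  case: xgetP => [z _ [m' [n' [[/i_inj <- /i_inj <-] ->]]]//|/=].
  by move=> /(_ (i (choice.pickle (0, 0)))) []; exists 0, 0.
have [[j [jX jinj]]|[h [hX hinj]]] := set_comparable X.
  exfalso; have [Y [g [gadm sub [y [Yy NXy]]]]] := admissible_extend Qf kinj kX jX jinj.
  apply: (Gmax _ _ gadm); rewrite GE; split=> // /graph2_sub[YX _].
  exact/NXy/YX.
have [fX finj] := Qf.
(* The tags [k 0] and [k 1] keep [X] and its complement apart, so [T] embeds in [X]. *)
pose e x := if `[< X x >] then f (x, k 0) else f (h x, k 1).
have eX x : X (e x).
  by rewrite /e; case: asboolP => ?; apply: fX => //; exact: hX.
have einj : injective e.
  move=> x y; rewrite /e; case: asboolP => Xx; case: asboolP => Xy.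
  - by move=> /finj[].
  - by move=> /finj[]//; [exact: hX|move=> _ /kinj].
  - by move=> /finj[]//; [exact: hX|move=> _ /kinj].
  - by move=> /finj[]//; [exact: hX|exact: hX|move=> /hinj ->].
exists (fun p => f (e p.1, e p.2)) => -[x y] [x' y'] /= /finj[]// /einj-> /einj->.
by [].
Qed.

End Hessenberg.

(* [small T A] means |A| < |T|. *)
Definition small (T U : Type) (A : set U) :=
  ~ exists f : T -> U, injective f /\ forall x, A (f x).

(** This is the initial ordinal of [T]: if some segment of a well-order is not small, [T] injects
    into the segment of the least such [z], and pulling the order back along this injection leaves
    only small segments. *)
Lemma small_segments_well_order (T : eqType) :
  exists lt : T -> T -> Prop,
    [/\ well_founded lt, forall x y z, lt x y -> lt y z -> lt x z,
        forall x y, [\/ lt x y, x = y | lt y x] &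
        forall a, small T [set x | lt x a]].
Proof.
have [r wo] := well_ordering_principle T.
have wo_chain_r : wo_chain r predT := withinW wo.
have r_tot x y : r x y || r y x by exact: (wo_chainW wo_chain_r).
have r_anti x y : r x y -> r y x -> x = y.
  by move=> rxy ryx; apply: (wo_chain_antisymmetric wo_chain_r) => //; exact/andP.
pose lt0 x y := x <> y /\ r x y.
have lt0_tot x y : [\/ lt0 x y, x = y | lt0 y x].
  have [->|xy] := pselect (x = y); first by constructor 2.
  have /orP[rxy|ryx] := r_tot x y; first by constructor 1.
  by constructor 3; split=> // /esym.
have min0 (S : set T) : S !=set0 -> exists2 z, S z & forall x, S x -> ~ lt0 x z.
  move=> [a Sa]; have [|z [[zS zmin] _]] := wo [pred x | x \in S].
    by exists a; exact/mem_set.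
  exists z; first exact/set_mem.
  move=> x Sx [xz rxz]; apply/xz/r_anti => //; apply: zmin.
  exact/mem_set.
have wf0 : well_founded lt0.
  move=> a; apply: contrapT => Na.
  have [|z Nz zmin] := min0 [set x | ~ Acc lt0 x]; first by exists a.
  apply: Nz; constructor => y ltyz; apply: contrapT => Ny.
  exact: zmin ltyz.
have lt0_trans x y z : lt0 x y -> lt0 y z -> lt0 x z.
  move=> xy yz; have [//|xz|zx] := lt0_tot x z.
    by case: xy yz => xy rxy [_ ryz]; case: xy; apply: r_anti => //; rewrite xz.
  have [|w /= wS wmin] := min0 [set x; y; z]; first by exists x; left; left.
  by case: wS wmin => [[->|->]|->] wmin; [case: (wmin z)|case: (wmin x)|case: (wmin y)];
    rewrite //=; tauto.
suff [g g_inj g_small] : exists2 g : T -> T, injective g &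
    forall a, small T [set x | lt0 x (g a)].
  exists (fun x y => lt0 (g x) (g y)); split.
  - move=> x; move: {2}(g x) (erefl (g x)) => y.
    elim/(well_founded_ind wf0): y x => y IH x gx.
    by constructor=> z gzx; apply: (IH (g z)) => //; rewrite -gx.
  - by move=> x y z; exact: lt0_trans.
  - move=> x y; have [xy|/g_inj xy|xy] := lt0_tot (g x) (g y);
    by [constructor 1|constructor 2|constructor 3].
  - move=> a [f [f_inj fa]]; apply: (g_small a); exists (g \o f); split=> //.
    exact: inj_comp.
have [small0|/existsNP[a /contrapT Na]] := pselect (forall a, small T [set x | lt0 x a]).
  by exists id.
have [|z /= /contrapT[g [g_inj gz]] zmin] := min0 [set a | ~ small T [set x | lt0 x a]].
  by exists a; exact.
exists g => // b; apply: contrapT => Nb; exact: (zmin (g b) Nb (gz b)).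
Qed.

(** The tool for avoiding forbidden values. If [g] covered the infinite [T], then [T] would embed in
    [A * A * K], which is finite when [A] is, and otherwise embeds in [A] by Hessenberg's
    theorem. *)
Lemma small_cover (T : Type) (U : pointedType) (K : finType) (e : nat -> T)
    (A : set U) (g : U -> U -> K -> T) : injective e -> small T A ->
  exists t, forall x y k, A x -> A y -> g x y k <> t.
Proof.
move=> e_inj A_small; apply: contrapT => /forallNP cover.
have /choice[h hP] t : exists p : U * U * K,
    [/\ A p.1.1, A p.1.2 & g p.1.1 p.1.2 p.2 = t].
  apply: contrapT => N; apply: (cover t) => x y k Ax Ay gt.
  by apply: N; exists (x, y, k).
have h_inj : injective h.
  by move=> s t; have [_ _ {2}<-] := hP s; have [_ _ {2}<-] := hP t => ->.
have [A_fin|/infiniteP/pcard_leP[i]] := pselect (finite_set A).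
  have : finite_set (A `*` A `*` [set: K]).
    by apply: finite_setX; [exact: finite_setX|exact: finite_finset].
  apply: contraPP => _; apply/infiniteP.
  have /injfunPex[f] : exists2 f : nat -> U * U * K,
      set_fun [set: nat] (A `*` A `*` [set: K]) f & {in [set: nat] &, injective f}.
    exists (h \o e); last by move=> m n _ _ /h_inj/e_inj.
    by move=> n _; have [? ? _] := hP (e n).
  exact: inj_card_le f.
apply: A_small.
have iA n : i n \in A by apply/mem_set/funS.
have [j j_inj] : exists j : nat -> A, injective j.
  by exists (fun n => SigSub (iA n)) => m n [] /inj; apply; exact: mem_setT.
have [f f_inj] := infinite_square_inj j_inj.
have h1 t : (h t).1.1 \in A by have [/mem_set] := hP t.
have h2 t : (h t).1.2 \in A by have [_ /mem_set] := hP t.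
exists (fun t => val (f (f (SigSub (h1 t) : A, SigSub (h2 t) : A), j (choice.pickle (h t).2)))).
split=> [s t /val_inj/f_inj[/f_inj[e1 e2] /j_inj]|t]; last exact/set_mem/valP.
move=> /(pcan_inj (@choice.pickleK _)) e3; apply: h_inj.
by move: e1 e2 e3; case: (h s) (h t) => [[? ?] ?] [[? ?] ?] /= -> -> ->.
Qed.

(** [T] contains two disjoint copies of itself. An injection [f] reaches [p] from at most one of
    them, so it maps the other into [A]. *)
Lemma small_setU1 (T : choiceType) (U : Type) (e : nat -> T) (A : set U) (p : U) :
  injective e -> small T A -> small T (A `|` [set p]).
Proof.
move=> e_inj A_small [f [f_inj fA]]; apply: A_small.
have [s s_inj] := infinite_square_inj e_inj.
have [n Nn] : exists n, forall t, f (s (t, e n)) <> p.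
  apply: contrapT => /forallNP N.
  have /existsNP[t /contrapT ft] := N 0%N.
  have /existsNP[t' /contrapT ft'] := N 1%N.
  by move: ft; rewrite -ft' => /f_inj/s_inj[_ /e_inj].
exists (fun t => f (s (t, e n))); split=> [t t' /f_inj/s_inj[]//|t].
by have [//|/Nn] := fA (s (t, e n)).
Qed.

(** An injection of [T] into the image would cover [T] by the unique preimages of the points
    [F b k], against [small_cover]. *)
Lemma small_image (T U V : pointedType) (K : finType) (e : nat -> T) (B : set U)
    (F : U -> K -> V) : injective e -> small T B ->
  small T [set p | exists b k, B b /\ p = F b k].
Proof.
move=> e_inj B_small [f [f_inj fB]].
have [t tP] := small_cover (fun b _ k => xget point [set t | f t = F b k]) e_inj B_small.
have [b [k [Bb ft]]] := fB t; apply: (tP b b k Bb Bb).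
by apply: xget_unique => // t' /=; rewrite -ft => /f_inj.
Qed.

Local Open Scope ring_scope.

(** * Planar sets without three collinear points *)

Section NoThreeCollinear.
Variable R : realType.
Implicit Types (p q r x y z : R * R) (A : set (R * R)).

(** Twice the signed area of the triangle, zero exactly for collinear points. *)
Definition det p q r := (q.1 - p.1) * (r.2 - p.2) - (q.2 - p.2) * (r.1 - p.1).

Definition no3 A := forall p q r, A p -> A q -> A r -> det p q r = 0 ->
  [\/ p = q, q = r | p = r].

Lemma detC p q r : det p r q = - det p q r.
Proof. by rewrite /det; ring. Qed.

Lemma det_rot p q r : det q r p = det p q r.
Proof. by rewrite /det; ring. Qed.

Lemma no3_add A p : no3 A ->
  (forall y z, A y -> A z -> y <> z -> det y z p <> 0) -> no3 (A `|` [set p]).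
Proof.
move=> A3 Ap a b c [Aa|->] [Ab|->] [Ac|->] d0;
  try by [constructor 1|constructor 2|constructor 3].
- exact: A3.
- by have [->|/(Ap _ _ Aa Ab)//] := pselect (a = b); constructor 1.
- have [->|/(Ap _ _ Aa Ac)] := pselect (a = c); first by constructor 3.
  by rewrite detC d0 oppr0.
- have [->|/(Ap _ _ Ab Ac)] := pselect (b = c); first by constructor 2.
  by rewrite det_rot.
Qed.

Lemma sub_no3 A B : B `<=` A -> no3 A -> no3 B.
Proof. by move=> BA A3 p q r /BA Ap /BA Aq /BA; exact: A3. Qed.

Lemma natr_inj : injective (fun n : nat => n%:R : R).
Proof. by move=> m n /eqP; rewrite eqr_nat => /eqP. Qed.

Lemma pair_neq_sub p q : p <> q -> q.1 - p.1 <> 0 \/ q.2 - p.2 <> 0.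
Proof.
move=> pq; apply: contrapT => /not_orP[/contrapT/subr0_eq e1 /contrapT/subr0_eq e2].
by apply: pq; rewrite [p]surjective_pairing [q]surjective_pairing e1 e2.
Qed.

(** The line through [y] and [z] contains both [p] and [q], hence is the given line. *)
Lemma det0_on_line (a b c : R) p q y z : y <> z -> p <> q ->
  a * p.1 + b * p.2 = c -> a * q.1 + b * q.2 = c ->
  det y z p = 0 -> det y z q = 0 -> a * y.1 + b * y.2 = c.
Proof.
move=> yz pq ap aq; rewrite /det => dp dq.
set u := z.1 - y.1 in dp dq; set v := z.2 - y.2 in dp dq.
have uv : u <> 0 \/ v <> 0 := pair_neq_sub yz.
have e1 : (q.1 - p.1) * v = (q.2 - p.2) * u by lra.
have e2 : a * (q.1 - p.1) + b * (q.2 - p.2) = 0 by lra.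
have pq' := pair_neq_sub pq.
have e3 : a * u + b * v = 0.
  have m1 : (q.1 - p.1) * (a * u + b * v) = u * (a * (q.1 - p.1) + b * (q.2 - p.2)).
    by rewrite mulrDr mulrCA (mulrCA _ b) e1; ring.
  have m2 : (q.2 - p.2) * (a * u + b * v) = v * (a * (q.1 - p.1) + b * (q.2 - p.2)).
    by rewrite mulrDr mulrCA -e1; ring.
  move: m1 m2; rewrite e2 !mulr0 => /eqP; rewrite mulf_eq0 => /orP[/eqP h1|/eqP//].
  by move=> /eqP; rewrite mulf_eq0 => /orP[/eqP h2|/eqP//]; case: pq'.
(* [w] is the defect of [y] in the equation of the line; since [(u, v)] is nonzero, it is enough to
   kill [v * w] and [u * w]. *)
set w := a * (p.1 - y.1) + b * (p.2 - y.2).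
have vw : v * w = 0.
  have -> : v * w = - (a * (u * (p.2 - y.2) - v * (p.1 - y.1))) +
    (a * u + b * v) * (p.2 - y.2) by rewrite /w; ring.
  by rewrite dp e3; ring.
have uw : u * w = 0.
  have -> : u * w = b * (u * (p.2 - y.2) - v * (p.1 - y.1)) +
    (a * u + b * v) * (p.1 - y.1) by rewrite /w; ring.
  by rewrite dp e3; ring.
have w0 : w = 0.
  move: uw vw => /eqP; rewrite mulf_eq0 => /orP[/eqP h1|/eqP//].
  by move=> /eqP; rewrite mulf_eq0 => /orP[/eqP h2|/eqP//]; case: uv.
by rewrite -ap; move: w0; rewrite /w; lra.
Qed.

Lemma line_det0 (a b c : R) p q r : (a, b) <> (0, 0) ->
  line a b c p -> line a b c q -> line a b c r -> det p q r = 0.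
Proof.
rewrite /line /det /= => ab pL qL rL.
have ea : a * ((q.1 - p.1) * (r.2 - p.2) - (q.2 - p.2) * (r.1 - p.1)) = 0.
  have -> : a * ((q.1 - p.1) * (r.2 - p.2) - (q.2 - p.2) * (r.1 - p.1)) =
    (a * q.1 + b * q.2 - (a * p.1 + b * p.2)) * (r.2 - p.2) -
    (a * r.1 + b * r.2 - (a * p.1 + b * p.2)) * (q.2 - p.2) by ring.
  by rewrite pL qL rL; ring.
have eb : b * ((q.1 - p.1) * (r.2 - p.2) - (q.2 - p.2) * (r.1 - p.1)) = 0.
  have -> : b * ((q.1 - p.1) * (r.2 - p.2) - (q.2 - p.2) * (r.1 - p.1)) =
    (a * r.1 + b * r.2 - (a * p.1 + b * p.2)) * (q.1 - p.1) -
    (a * q.1 + b * q.2 - (a * p.1 + b * p.2)) * (r.1 - p.1) by ring.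
  by rewrite pL qL rL; ring.
move: ea eb => /eqP; rewrite mulf_eq0 => /orP[/eqP a0|/eqP//].
by move=> /eqP; rewrite mulf_eq0 => /orP[/eqP b0|/eqP//]; case: ab; rewrite a0 b0.
Qed.

(** Unless the line already meets [A] outside [x], each pair of points of [A] forbids at most one
    point of it, so some point is left. Avoiding [x] lets a second application yield a second
    point. *)
Lemma no3_add_line A (a b c : R) x : (a, b) <> (0, 0) -> no3 A -> small R A -> A x ->
  exists p, [/\ a * p.1 + b * p.2 = c, p <> x & no3 (A `|` [set p])].
Proof.
move=> ab A3 A_small Ax.
have [[p [Ap pL px]]|N] := pselect (exists p, [/\ A p, a * p.1 + b * p.2 = c & p <> x]).
  exists p; split=> //; suff -> : A `|` [set p] = A by [].
  by apply: setUidl => _ ->.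
have n0 : a ^+ 2 + b ^+ 2 != 0.
  apply/eqP => ab0; apply: ab; congr pair; nra.
(* The foot of the perpendicular from the origin, moved along the direction [(- b, a)]. *)
pose P (r : R) : R * R :=
  (a * c / (a ^+ 2 + b ^+ 2) - b * r, b * c / (a ^+ 2 + b ^+ 2) + a * r).
have PL (r : R) : a * (P r).1 + b * (P r).2 = c by rewrite /P /=; field.
have P_inj : injective P.
  move=> r r' [/addrI/oppr_inj e1 /addrI e2].
  have e3 : (a ^+ 2 + b ^+ 2) * (r - r') = 0.
    have -> : (a ^+ 2 + b ^+ 2) * (r - r') =
      a * (a * r - a * r') + b * (b * r - b * r') by ring.
    by rewrite e1 e2; ring.
  by move/eqP: e3; rewrite mulf_eq0 (negPf n0) subr_eq0 => /eqP.
(* The diagonal pairs exclude the points of [A] themselves, in particular [x]. *)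
pose S y z := [set r | if y == z then P r = y else det y z (P r) = 0].
have [r rP] := small_cover (fun y z (_ : unit) => xget 0 (S y z)) natr_inj A_small.
exists (P r); split=> //.
  move=> Prx; apply: (rP x x tt Ax Ax); apply: xget_unique; rewrite /S /= eqxx//.
  by move=> r'; rewrite -Prx => /P_inj.
apply: no3_add => // y z Ay Az yz dr.
have Sr : S y z r by rewrite /S /=; case: eqP.
have := rP y z tt Ay Az; case: xgetP => [r' _|/(_ r)//]; rewrite /S /=.
case: eqP => // _ dr' r'r.
(* Two forbidden parameters for one pair would put both [y] and [z] on the line, where [N] leaves
   only [x]. *)
have PP : P r' <> P r by move=> /P_inj.
have yL := det0_on_line yz PP (PL _) (PL _) dr' dr.
have zL : a * z.1 + b * z.2 = c.
  apply: (det0_on_line (nesym yz) PP (PL _) (PL _)).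
    by rewrite detC det_rot -[RHS]oppr0 -dr'; congr -%R; rewrite /det; ring.
  by rewrite /det -[RHS]oppr0 -dr /det; ring.
apply: yz; transitivity x; apply: contrapT => h; apply: N; [by exists y|].
by exists z; split=> // /esym.
Qed.

Definition unrot (t s h : R) : R * R := (cos t * s + sin t * h, cos t * h - sin t * s).

Lemma rotation_unrot t s h : rotation t (unrot t s h) = (s, h).
Proof.
have := cos2Dsin2 t; rewrite /rotation /unrot /= => cs.
by congr pair; rewrite -[RHS]mul1r -cs; ring.
Qed.

(** Rotations preserve area, and the rotation by [t] makes the last two points vertically aligned:
    the area is base times height. *)
Lemma det_unrot t y s h h' :
  det y (unrot t s h) (unrot t s h') = (s - (rotation t y).1) * (h' - h).
Proof.
have := cos2Dsin2 t; rewrite /rotation /unrot /det /= => cs.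
by rewrite -[X in _ = (X - _) * _]mul1r -cs; ring.
Qed.

(* Being aligned with two given points of A is a quadratic condition on the
   abscissa s; it is never trivial because a parabola contains no segment. *)
Lemma no3_add_chord A t : no3 A -> small R A ->
  exists s, (forall p, A p -> (rotation t p).1 <> s) /\
    no3 (A `|` [set unrot t s (s ^+ 2)] `|` [set unrot t s (s ^+ 2 + 1)]).
Proof.
move=> A3 A_small.
pose D y z (e : bool) s := det y z (unrot t s (s ^+ 2 + e%:R)).
(* As a polynomial in [s], [D] has leading coefficient [al] and linear coefficient [- be]. The
   vector [(al, be)] is [z - y] rotated by [t], so it is nonzero when [y <> z]. *)
pose al y z := (z.1 - y.1) * cos t - (z.2 - y.2) * sin t.
pose be y z := (z.1 - y.1) * sin t + (z.2 - y.2) * cos t.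
pose root y z e := xget 0 [set s | D y z e s = 0].
(* The excluded abscissae are those of the rotated [A], one root of [D], and the other root by
   Vieta's formula. *)
pose g y z (k : option (bool * bool)) := match k with
  | None => (rotation t y).1
  | Some (e, true) => root y z e
  | Some (e, false) => be y z / al y z - root y z e
  end.
have [s sP] := small_cover g natr_inj A_small.
have As p : A p -> (rotation t p).1 <> s by move=> Ap; exact: (sP p p None Ap Ap).
have AD y z e : A y -> A z -> y <> z -> D y z e s <> 0.
  move=> Ay Az yz Ds.
  have := sP y z (Some (e, true)) Ay Az; have := sP y z (Some (e, false)) Ay Az.
  rewrite /g /root; case: xgetP => [s0 _ /= Ds0|/(_ s)//] other s0s.
  have : (s - s0) * (al y z * (s + s0) - be y z) = D y z e s - D y z e s0.
    by rewrite /D /det /al /be /unrot /=; ring.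
  rewrite Ds Ds0 subrr => /eqP; rewrite mulf_eq0 subr_eq0 => /orP[/eqP//|].
    by move=> /esym.
  move=> /eqP e1.
  have [al0|/eqP al0] := eqVneq (al y z) 0; last first.
    apply: other; apply/eqP; rewrite subr_eq -[X in _ == X](mulKf (introN eqP al0)).
    by rewrite mulrC; apply/eqP; congr *%R; lra.
  have be0 : be y z = 0 by move: e1; rewrite al0; lra.
  have cs := cos2Dsin2 t; have := pair_neq_sub yz; move: al0 be0; rewrite /al /be.
  set u := z.1 - y.1; set v := z.2 - y.2 => al0 be0.
  have u0 : u = 0.
    have -> : u = cos t * (u * cos t - v * sin t) + sin t * (u * sin t + v * cos t).
      by rewrite -[LHS]mulr1 -cs; ring.
    by rewrite al0 be0; ring.
  have v0 : v = 0.
    have -> : v = cos t * (u * sin t + v * cos t) - sin t * (u * cos t - v * sin t).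
      by rewrite -[LHS]mulr1 -cs; ring.
    by rewrite al0 be0; ring.
  by case.
exists s; split=> //; apply: no3_add.
  apply: no3_add => // y z Ay Az yz.
  by have := AD y z false Ay Az yz; rewrite /D addr0.
have chord y : A y -> det y (unrot t s (s ^+ 2)) (unrot t s (s ^+ 2 + 1)) <> 0.
  move=> Ay; rewrite det_unrot addrAC subrr add0r mulr1 => /eqP.
  by rewrite subr_eq0 => /eqP/esym; exact: As.
move=> y z [Ay|->] [Az|->] yz //.
- exact: (AD y z true Ay Az yz).
- exact: chord.
- by rewrite -det_rot detC => /eqP; rewrite oppr_eq0 => /eqP; exact: chord.
Qed.

(* Transfinite recursion of length |R|: at each stage fewer than |R| points have
   been chosen. *)
Lemma no3_transfinite (K : finType)
    (spec : R -> set (R * R) -> (K -> R * R) -> Prop) :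
  (forall a A, no3 A -> small R A ->
     exists w, spec a A w /\ no3 (A `|` range w)) ->
  exists (lt : R -> R -> Prop) (F : R -> K -> R * R),
    [/\ forall a b, [\/ lt a b, a = b | lt b a],
        no3 [set p | exists b k, p = F b k] &
        forall a, spec a [set p | exists b k, lt b a /\ p = F b k] (F a)].
Proof.
move=> step.
have [lt [wf lt_trans lt_tot lt_small]] := small_segments_well_order R.
(* The recursion needs a total [w]; the default 0 is never met, as induction shows afterwards that
   every stage satisfies both hypotheses. *)
have /choice[w wP] (aA : R * set (R * R)) : exists w : K -> R * R,
    no3 aA.2 -> small R aA.2 -> spec aA.1 aA.2 w /\ no3 (aA.2 `|` range w).
  have [A3|N] := pselect (no3 aA.2); last by exists (fun=> 0).
  have [sA|N] := pselect (small R aA.2); last by exists (fun=> 0).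
  by have [w ?] := step aA.1 _ A3 sA; exists w.
pose body a (rec : forall b, lt b a -> K -> R * R) :=
  w (a, [set p | exists b (h : lt b a) k, p = rec b h k]).
pose F := Fix wf (fun=> K -> R * R) body.
pose prev a := [set p | exists b k, lt b a /\ p = F b k].
have FE a : F a = w (a, prev a).
  rewrite /F Fix_eq -/F; last first.
    move=> b f g fg; suff -> : f = g by [].
    by apply: functional_extensionality_dep => c; apply: functional_extensionality_dep.
  congr (w (a, _)); apply/seteqP; split=> p /=.
    by move=> [b [h [k ->]]]; exists b, k.
  by move=> [b [k [h ->]]]; exists b, h, k.
pose upto a := prev a `|` range (F a).
have upto_le a b k : lt a b \/ a = b -> upto b (F a k).
  by move=> [ab|->]; [left; exists a, k|right; exists k].
(* Collinearity involves three points, all present by the largest of their three stages, so [no3]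
   passes from the stages to their union. *)
have common a b c : exists d, [/\ lt a d \/ a = d, lt b d \/ b = d, lt c d \/ c = d &
    [\/ d = a, d = b | d = c]].
  have [e [ae be eE]] : exists e, [/\ lt a e \/ a = e, lt b e \/ b = e & e = a \/ e = b].
    have [ab|<-|ba] := lt_tot a b; [exists b|exists a|exists a]; split; tauto.
  have [ec|<-|ce] := lt_tot e c; last 2 first.
  - by exists e; split=> //; [right|constructor 3].
  - by exists e; split=> //; [left|case: eE => eE; [constructor 1|constructor 2]].
  have lec (x : R) : lt x e \/ x = e -> lt x c \/ x = c.
    by move=> [xe|->]; left => //; exact: lt_trans ec.
  by exists c; split; [exact: lec|exact: lec|right|constructor 3].
have no3_union (S : set R) : (forall a, S a -> no3 (upto a)) ->
    no3 [set p | exists b k, S b /\ p = F b k].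
  move=> S3 p q r [b [k [Sb ->]]] [b' [k' [Sb' ->]]] [b'' [k'' [Sb'' ->]]].
  have [d [bd bd' bd'' dE]] := common b b' b''.
  by apply: (S3 d); [case: dE => ->|exact: upto_le..].
have prev_small a : small R (prev a).
  exact: (@small_image R R (R * R)%type K _ _ F natr_inj (lt_small a)).
have upto3 a : no3 (upto a).
  elim/(well_founded_ind wf): a => a IH; have p3 : no3 (prev a) by exact: no3_union.
  by rewrite /upto FE; exact: (wP (a, prev a) p3 (prev_small a)).2.
exists lt, F; split=> // [p q r [b [k ->]] [b' [k' ->]] [b'' [k'' ->]]|a].
  by apply: (@no3_union setT) => //; [exists b, k|exists b', k'|exists b'', k''].
have p3 : no3 (prev a) by exact: no3_union.
by rewrite -/(prev a) FE; exact: (wP (a, prev a) p3 (prev_small a)).1.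
Qed.

(** The first bit of the index separates the parabola pair ([false]) from the line pair ([true]).
    The abscissa [s] is new so that distinct stages with the same angle have distinct abscissae. *)
Lemma no3_stage (a b c t : R) A : no3 A -> small R A ->
  exists w : bool * bool -> R * R,
    [/\ exists s, [/\ forall p, A p -> (rotation t p).1 <> s,
                     w (false, false) = unrot t s (s ^+ 2) &
                     w (false, true) = unrot t s (s ^+ 2 + 1)],
        (a, b) <> (0, 0) -> [/\ w (true, false) <> w (true, true),
          line a b c (w (true, false)) & line a b c (w (true, true))] &
        no3 (A `|` range w)].
Proof.
move=> A3 A_small; have [s [As]] := no3_add_chord t A3 A_small.
set q := unrot t s _; set q' := unrot t s _; set B := A `|` _ `|` _ => B3.
have B_small : small R B by do 2![apply: (small_setU1 natr_inj)].
pose w p p' (k : bool * bool) :=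
  if k.1 then (if k.2 then p' else p) else (if k.2 then q' else q).
have Bq' : B q' by right.
have [ab0|ab] := pselect ((a, b) = (0, 0)).
  exists (w q q); split=> //; first by exists s.
  apply: sub_no3 B3 => x [Ax|[[[] []] _ <-]]; rewrite /w /B /=; tauto.
(* The first point on the line avoids [q'], a point known to be in [B]; the second will avoid the
   first. *)
have [p [pL pq' Bp3]] := no3_add_line c ab B3 B_small Bq'.
have Bp_small := small_setU1 (p := p) natr_inj B_small.
have Bp : (B `|` [set p]) p by right.
have [p' [p'L p'p Bpp'3]] := no3_add_line c ab Bp3 Bp_small Bp.
exists (w p p'); split=> //; first by exists s.
  by move=> _; split=> // /esym.
apply: sub_no3 Bpp'3 => x [Ax|[[[] []] _ <-]]; rewrite /w /B /=; tauto.
Qed.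

End NoThreeCollinear.

(** * The Mazurkiewicz set *)

Local Open Scope card_scope.

Lemma no3_mazurkiewicz (R : realType) (M : set (R * R)) : no3 M ->
  (forall a b c : R, (a, b) <> (0, 0) ->
     exists p q, [/\ M p, M q, p <> q, line a b c p & line a b c q]) ->
  mazurkiewicz M.
Proof.
move=> M3 M2 _ [a [b [c [ab ->]]]]; have [p [q [Mp Mq pq pL qL]]] := M2 a b c ab.
have -> : M `&` line a b c = [set` [fset p; q]%fset].
  apply/seteqP; split=> r /=; last by rewrite !inE => /orP[] /eqP ->.
  move=> [Mr rL]; rewrite !inE; apply/orP.
  have [//|e|e] := M3 p q r Mp Mq Mr (line_det0 ab pL qL rL); [right|left]; exact/eqP.
by apply/card_eq_fsetP; rewrite cardfs2; case: eqP.
Qed.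

Lemma not_card_lt_inj (T U : Type) (X : set T) (f : U -> T) :
  injective f -> (forall u, X (f u)) -> ~ card_lt X [set: U].
Proof.
move=> f_inj fX [XU /negP]; apply; rewrite card_eq_le XU /=.
have /injfunPex[g] : exists2 g : U -> T,
    set_fun [set: U] X g & {in [set: U] &, injective g}.
  by exists f => // u v _ _ /f_inj.
exact: inj_card_le g.
Qed.

Theorem theorem3p4 (R : realType) :
  exists M : set (R * R),
    mazurkiewicz M /\
    forall t : R, forall f : R -> R, sierpinski_zygmund_fun f ->
      ~ (graph_on [set: R] f `<=` rotation t @` M).
Proof.
have [pr pr_inj] := infinite_square_inj (@natr_inj R).
(* A stage codes a line, an angle and a label in [R * R]; the labels make every angle recur |R|
   times. *)
pose enc (z : R * R * R * R * (R * R)) :=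
  pr (pr (pr (pr (z.1.1.1.1, z.1.1.1.2), z.1.1.2), z.1.2), pr z.2).
have enc_inj : injective enc.
  move=> [[[[? ?] ?] ?] [? ?]] [[[[? ?] ?] ?] [? ?]].
  by move=> /pr_inj[/pr_inj[/pr_inj[/pr_inj[-> ->] ->] ->] /pr_inj[-> ->]].
pose dec x := xget 0 [set z | enc z = x].
have encK : cancel enc dec by move=> z; apply: xget_unique => // z' /enc_inj.
pose spec x (A : set (R * R)) (w : bool * bool -> R * R) :=
  let: (a, b, c, t, _) := dec x in
  (exists s, [/\ forall p, A p -> (rotation t p).1 <> s,
                 w (false, false) = unrot t s (s ^+ 2) &
                 w (false, true) = unrot t s (s ^+ 2 + 1)]) /\
  ((a, b) <> (0, 0) -> [/\ w (true, false) <> w (true, true),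
      line a b c (w (true, false)) & line a b c (w (true, true))]).
have [|lt [F [lt_tot M3 FP]]] := @no3_transfinite R _ spec.
  move=> x A A3 A_small; rewrite /spec; case: (dec x) => [[[[a b] c] t] _].
  by have [w [? ? ?]] := no3_stage a b c t A3 A_small; exists w.
pose M := [set p | exists b k, p = F b k].
exists M; split.
  apply: no3_mazurkiewicz => // a b c ab.
  have := FP (enc (a, b, c, 0, (0, 0))); rewrite /spec encK => -[_ /(_ ab)[]].
  set x := enc _ => *; exists (F x (true, false)), (F x (true, true)); split=> //.
    by exists x, (true, false).
  by exists x, (true, true).
move=> t f f_SZ fM; pose x (e : R * R) := enc (0, 0, 0, t, e).
have /choice[s sP] e : exists s, [/\
    forall p, (exists b k, lt b (x e) /\ p = F b k) -> (rotation t p).1 <> s,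
    F (x e) (false, false) = unrot t s (s ^+ 2) &
    F (x e) (false, true) = unrot t s (s ^+ 2 + 1)].
  by have := FP (x e); rewrite /spec encK => -[].
have s_lt e e' : lt (x e) (x e') -> s e <> s e'.
  move=> ee'; have [+ _ _] := sP e'; have [_ Fe _] := sP e.
  move=> /(_ (F (x e) (false, false))); rewrite Fe rotation_unrot /=; apply.
  by exists (x e), (false, false).
have s_inj : injective s.
  move=> e e' see'; have [/s_lt//|/enc_inj[]|/s_lt] := lt_tot (x e) (x e').
    by [].
  by rewrite see'.
(* The point of [M] that rotates to [(s e, f (s e))] is collinear with the two parabola points of
   the stage [x e], so by [no3] it is one of them. *)
have f_s e : f (s e) = s e ^+ 2 \/ f (s e) = s e ^+ 2 + 1.
  have [|m Mm mE] := fM (s e, f (s e)); first by [].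
  have [_ Fq Fq'] := sP e.
  have : [\/ m = unrot t (s e) (s e ^+ 2), 
             unrot t (s e) (s e ^+ 2) = unrot t (s e) (s e ^+ 2 + 1) |
             m = unrot t (s e) (s e ^+ 2 + 1)].
    apply: M3 => //; [by exists (x e), (false, false)|by exists (x e), (false, true)|].
    by rewrite det_unrot mE /= subrr mul0r.
  case=> [mq|/(congr1 (rotation t))|mq].
  - by left; move: mE; rewrite mq rotation_unrot => -[].
  - by rewrite !rotation_unrot => -[]; lra.
  - by right; move: mE; rewrite mq rotation_unrot => -[].
have N (h : R -> R) (e : R -> R * R) : continuous h -> injective e ->
    ~ forall r, f (s (e r)) = h (s (e r)).
  move=> h_cont e_inj fh.
  apply: (@not_card_lt_inj _ _ _ (fun r => (s (e r), f (s (e r)))) _ _ (f_SZ setT h _)).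
  - by move=> r r' [/s_inj/e_inj].
  - by move=> r; split; split=> //=; exact: fh.
  - exact: continuous_subspaceT.
(* Labels are pairs to make this dichotomy work: either some row [a] takes only values on the first
   parabola, or every row has a point on the second. Both cases give |R| agreements. *)
have [[a aP]|/forallNP Na] :=
    pselect (exists a, forall b, ~ f (s (a, b)) = s (a, b) ^+ 2 + 1).
  apply: (N (fun r => r ^+ 2) (fun b => (a, b))).
  - by move=> r; exact: exprn_continuous.
  - by move=> r r' [].
  - by move=> r; have [//|/aP] := f_s (a, r).
have /choice[e eP] a : exists b, f (s (a, b)) = s (a, b) ^+ 2 + 1.
  by apply: contrapT => /forallNP; exact: Na.
apply: (N (fun r => r ^+ 2 + 1) (fun a => (a, e a))) => //.
- by move=> r; apply: cvgD; [exact: exprn_continuous|exact: cvg_cst].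
- by move=> r r' [].
Qed.
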